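(* Let $X$ be a strictly convex and reflexive real Banach space that contains $\mathcal{I}_N(\Omega)$ and whose dual $X^*$ is strictly convex, and let $\mathcal{F}:X\to\mathbb{R}\cup\{+\infty\}$ be proper, convex and lower semicontinuous with respect to the topology of $X$. Let $\rho_{\mathrm{gs}}\in X$ be $v$-representable with respect to $\mathcal{F}$, i.e. $\underline{\partial}\mathcal{F}(\rho_{\mathrm{gs}})\neq\emptyset$. For $\varepsilon>0$ let $$v^\varepsilon=\frac1\varepsilon J\big(\Pi^\varepsilon_{\mathcal{F}}(\rho_{\mathrm{gs}})-\rho_{\mathrm{gs}}\big)\in X^*.$$ Then a representing potential $v\in-\underline{\partial}\mathcal{F}(\rho_{\mathrm{gs}})$ is given by the weak limit $$v=\operatorname*{w\text{-}lim}_{\varepsilon\to0^+}v^\varepsilon=\operatorname*{w\text{-}lim}_{\varepsilon\to0^+}J\Big(\frac1\varepsilon\big(\Pi^\varepsilon_{\mathcal{F}}(\rho_{\mathrm{gs}})-\rho_{\mathrm{gs}}\big)\Big).$$ If $X=\mathcal{H}$ is a Hilbert space, then moreover $$v=J\Big(\lim_{\varepsilon\to0^+}\frac1\varepsilon\big(\Pi^\varepsilon_{\mathcal{F}}(\rho_{\mathrm{gs}})-\rho_{\mathrm{gs}}\big)\Big)$$ (limit in the norm of $\mathcal{H}$), and for any $\tilde\rho_{\mathrm{gs}}\in\mathcal{H}$ and $\varepsilon>0$, with $\tilde v^\varepsilon=\frac1\varepsilon J\big(\Pi^\varepsilon_{\mathcal{F}}(\tilde\rho_{\mathrm{gs}})-\tilde\rho_{\mathrm{gs}}\big)$,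 it holds that $$\|v-\tilde v^\varepsilon\|_{\mathcal{H}^*}\le\|v-v^\varepsilon\|_{\mathcal{H}^*}+\frac1\varepsilon\|\rho_{\mathrm{gs}}-\tilde\rho_{\mathrm{gs}}\|_{\mathcal{H}}.$$
   Context: $\Omega$ is an open subset of $\mathbb{R}^d$ or the flat torus $\mathbb{T}^d$ ($d\ge1$), $N\ge1$ is an integer, and $\mathcal{I}_N(\Omega)$ is the set of (nonnegative) functions $\rho\in L^1(\Omega)$ with $\sqrt\rho\in H^1(\Omega)$ (with the boundary conditions of the problem, e.g. periodic ones) and $\int_\Omega\rho=N$. $\langle u,\rho\rangle$ denotes the dual pairing of $u\in X^*$ and $\rho\in X$. The (normalised) duality mapping is $J(\rho)=\{u\in X^*:\langle u,\rho\rangle=\|\rho\|_X^2=\|u\|_{X^*}^2\}$; it is single-valued when $X^*$ is strictly convex, and is then regarded as a map $J:X\to X^*$ (on a Hilbert space it is the Riesz map). The subdifferential of a proper convex lower semicontinuous $f:X\to\mathbb{R}\cup\{+\infty\}$ at $\rho$ is $\underline{\partial}f(\rho)=\{u\in X^*:f(\rho')\ge f(\rho)+\langle u,\rho'-\rho\rangle\ \forall\rho'\in X\}$. A density $\rho_{\mathrm{gs}}\in X$ is $v$-representable with respect to $\mathcal{F}$ if $\underline{\partial}\mathcal{F}(\rho_{\mathrm{gs}})\ne\emptyset$; any $v\in X^*$ with $v\in-\underline{\partial}\mathcal{F}(\rho_{\mathrm{gs}})$ is called a representing potential. The proximal mapping is $\Pi^\varepsilon_f(\rho)=\operatorname{argmin}_{\sigma\in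 X}\{f(\sigma)+\frac1{2\varepsilon}\|\sigma-\rho\|_X^2\}$ for $\varepsilon>0$; in a reflexive strictly convex space the minimiser exists and is unique, so $\Pi_f^\varepsilon:X\to X$ is well defined. *)

(* Defs.v *)
From HB Require Import structures.
From mathcomp Require Import all_boot all_order all_algebra.
From mathcomp Require Import all_classical all_reals all_analysis.

Set Implicit Arguments.
Unset Strict Implicit.
Unset Printing Implicit Defensive.

Import Order.TTheory GRing.Theory Num.Theory.
Import numFieldNormedType.Exports.

Local Open Scope classical_set_scope.
Local Open Scope ring_scope.

Section dual_type.
Context {R : realType} (X : normedModType R).

Definition dual_pred : {pred X -> R^o} :=
  fun f => `[< linear f /\ continuous f >].

Record dual := Dual {
  dual_fun :> X -> R^o ;
  dual_funP : dual_fun \in dual_pred }.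

HB.instance Definition _ := [isSub for dual_fun].
HB.instance Definition _ := [Choice of dual by <:].

Lemma dual_submod_closed : submod_closed dual_pred.
Proof.
split=> [|a f g].
  apply/asboolP; split; first by move=> k x y /=; rewrite scaler0 addr0.
  by move=> x; exact: cvg_cst.
move=> /asboolP[lf cf] /asboolP[lg cg]; apply/asboolP; split.
  move=> k x y /=; rewrite !fctE lf lg !scalerDr !scalerA (mulrC a).
  by rewrite addrACA.
by move=> x; apply: cvgD; [apply: cvgZl_tmp; exact: cf|exact: cg].
Qed.

HB.instance Definition _ :=
  GRing.isSubmodClosed.Build R (X -> R^o) dual_pred dual_submod_closed.
HB.instance Definition _ := [SubChoice_isSubLmodule of dual by <:].

End dual_type.

Section dual_linear.
Context {R : realType} (X : normedModType R) (u : dual X).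

Lemma dual_linear : linear u.
Proof. by case: u => f /= /asboolP[]. Qed.

Lemma dual_continuous : continuous u.
Proof. by case: u => f /= /asboolP[]. Qed.

HB.instance Definition _ := GRing.isLinear.Build R X R^o *:%R u dual_linear.

End dual_linear.

Section dual_norm.
Context {R : realType} (X : normedModType R).
Implicit Types u w : dual X.

Lemma dualDE u w x : (u + w) x = u x + w x. Proof. by []. Qed.

Lemma dualZE a u x : (a *: u) x = a * u x. Proof. by []. Qed.

Definition dual_norm u : R :=
  sup [set `|u x| | x in [set x : X | `|x| <= 1]].

Lemma dual_norm_has_sup u : has_sup [set `|u x| | x in [set x : X | `|x| <= 1]].
Proof.
split; first by exists `|u 0|; exists 0 => //=; rewrite normr0.
have /linear_boundedP/pinfty_ex_gt0[M M0 Mu] :=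
  @continuous_linear_bounded R X R^o 0 u (@dual_continuous R X u 0).
exists M => _ [x /= x1 <-]; rewrite (le_trans (Mu x))//.
by rewrite ler_piMr// ltW.
Qed.

Lemma dual_norm_ge0 u : 0 <= dual_norm u.
Proof.
apply: (@le_trans _ _ `|u 0|) => //.
apply: ub_le_sup; first by case: (dual_norm_has_sup u).
by exists 0 => //=; rewrite normr0.
Qed.

Lemma dual_norm_ub u x : `|u x| <= dual_norm u * `|x|.
Proof.
have [->|x0] := eqVneq x 0; first by rewrite linear0 !normr0 mulr0.
rewrite -ler_pdivrMr ?normr_gt0//.
have -> : `|u x| / `|x| = `|u (`|x|^-1 *: x)|.
  by rewrite linearZ normrM normfV normr_id mulrC.
apply: ub_le_sup; first by case: (dual_norm_has_sup u).
exists (`|x|^-1 *: x) => //=.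
by rewrite normrZ normfV normr_id mulVf// normr_eq0.
Qed.

Lemma dual_norm_le u (M : R) :
  0 <= M -> (forall x, `|u x| <= M * `|x|) -> dual_norm u <= M.
Proof.
move=> M0 Mu; apply: ge_sup; first by case: (dual_norm_has_sup u).
by move=> _ [x /= x1 <-]; rewrite (le_trans (Mu x))// ler_piMr.
Qed.

Lemma dual_ler_normD u w : dual_norm (u + w) <= dual_norm u + dual_norm w.
Proof.
apply: dual_norm_le => [|x]; first by rewrite addr_ge0// dual_norm_ge0.
by rewrite dualDE (le_trans (ler_normD _ _))// mulrDl lerD// dual_norm_ub.
Qed.

Lemma dual_normrZ_le a u : dual_norm (a *: u) <= `|a| * dual_norm u.
Proof.
apply: dual_norm_le => [|x]; first by rewrite mulr_ge0// dual_norm_ge0.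
by rewrite dualZE normrM -mulrA ler_wpM2l// dual_norm_ub.
Qed.

Lemma dual_normrZ a u : dual_norm (a *: u) = `|a| * dual_norm u.
Proof.
apply/eqP; rewrite eq_le dual_normrZ_le/=.
have [->|a0] := eqVneq a 0; first by rewrite normr0 mul0r dual_norm_ge0.
rewrite -ler_pdivlMl ?normr_gt0// -normfV.
by rewrite (le_trans _ (dual_normrZ_le _ _))// scalerA mulVf// scale1r.
Qed.

Lemma dual_normr0_eq0 u : dual_norm u = 0 -> u = 0.
Proof.
move=> u0; apply/val_inj/funext => x /=.
by apply/eqP; rewrite -normr_le0 (le_trans (dual_norm_ub u x))// u0 mul0r.
Qed.

HB.instance Definition _ := @Lmodule_isNormed.Build R (dual X) dual_norm
  dual_ler_normD dual_normrZ dual_normr0_eq0.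

Lemma dual_normE u : `|u| = dual_norm u. Proof. by []. Qed.

End dual_norm.

Section geometry.
Context {R : realType}.

Definition strictly_convex (X : normedModType R) :=
  forall x y : X, `|x| = 1 -> `|y| = 1 -> x != y -> `|2^-1 *: (x + y)| < 1.

Definition reflexive_space (X : normedModType R) :=
  forall phi : dual (dual X), exists x : X, forall u : dual X, phi u = u x.

Definition weak_cvg {T : Type} (F : set_system T) {Y : normedModType R}
    (u : T -> Y) (y : Y) :=
  forall phi : dual Y, (phi (u t) : R) @[t --> F] --> (phi y : R).

(* X is complete wherever this is used: the norm comes from an inner product. *)
Definition hilbert_norm (X : normedModType R) :=
  exists ip : X -> X -> R,
    [/\ forall x y, ip x y = ip y x,
        forall a x y z, ip (a *: x + y) z = a * ip x z + ip y z &
        forall x, ip x x = `|x| ^+ 2].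

End geometry.

Section convex_analysis.
Context {R : realType} {X : normedModType R}.
Implicit Types (f : X -> \bar R) (x y : X).

Definition duality_set x : set (dual X) :=
  [set u : dual X | u x = `|x| ^+ 2 /\ `|x| ^+ 2 = `|u| ^+ 2].

(* [xget] picks an element of the set; the default 0 is only reached on an
   empty set. When [dual X] is strictly convex the set is a singleton. *)
Definition duality_map x : dual X := xget 0 (duality_set x).

Definition proper_fun f :=
  (forall x, f x != -oo%E) /\ (exists x, (f x < +oo)%E).

Definition convex_efun f :=
  forall x y (t : R), 0 < t -> t < 1 ->
    (f (t *: x + (1 - t) *: y)%R <= t%:E * f x + (1 - t)%R%:E * f y)%E.

Definition subdifferential f x : set (dual X) :=
  [set u : dual X | forall y, (f x + (u (y - x)%R)%:E <= f y)%E].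

Definition v_representable f x := subdifferential f x !=set0.

Definition representing_potential f x : set (dual X) :=
  [set v : dual X | subdifferential f x (- v)].

Definition prox_set (e : R) f x : set X :=
  [set s | forall s',
    (f s + ((2 * e)^-1 * `|s - x| ^+ 2)%R%:E
     <= f s' + ((2 * e)^-1 * `|s' - x| ^+ 2)%R%:E)%E].

(* The default 0 is only reached when there is no minimiser. *)
Definition prox (e : R) f x : X := xget 0 (prox_set e f x).

Definition prox_potential f x (e : R) : dual X :=
  e^-1 *: duality_map (prox e f x - x).

Definition prox_quotient f x (e : R) : X := e^-1 *: (prox e f x - x).

End convex_analysis.

Section lebesgue.
Context {R : realType}.
Local Notation T := (measurableTypeR R).

Definition tuple_cons (n : nat) (p : n.-tuple T * T) : n.+1.-tuple T :=
  [tuple of p.2 :: p.1].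

Lemma measurable_tuple_cons n : measurable_fun setT (@tuple_cons n).
Proof. exact: measurable_cons. Qed.

Section step.
Context (n : nat) (mu : {measure set (n.-tuple T) -> \bar R}).

Let prod : {measure set (n.-tuple T * T) -> \bar R} :=
  (mu \x @lebesgue_measure R)%E.

Definition lebesgue_step := pushforward prod (@tuple_cons n).

Let step0 : lebesgue_step set0 = 0%E.
Proof. by rewrite /lebesgue_step /pushforward preimage_set0 measure0. Qed.

Let step_ge0 A : (0 <= lebesgue_step A)%E.
Proof. by rewrite /lebesgue_step /pushforward; exact: measure_ge0. Qed.

Let step_sigma_additive : semi_sigma_additive lebesgue_step.
Proof.
move=> F mF tF mUF; rewrite /lebesgue_step /pushforward preimage_bigcup.
apply: measure_semi_sigma_additive.
- by move=> k; rewrite -[X in measurable X]setTI; exact: measurable_tuple_cons.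
- apply/trivIsetP => /= i j _ _ ij; rewrite -preimage_setI.
  by move/trivIsetP : tF => /(_ _ _ _ _ ij) ->//; rewrite preimage_set0.
- rewrite -preimage_bigcup -[X in measurable X]setTI.
  exact: measurable_tuple_cons.
Qed.

HB.instance Definition _ := isMeasure.Build _ _ _ lebesgue_step
  step0 step_ge0 step_sigma_additive.

End step.

Fixpoint lebesgue_tuple (n : nat) : {measure set (n.-tuple T) -> \bar R} :=
  match n with
  | 0 => \d_([tuple] : 0.-tuple T)
  | n'.+1 => lebesgue_step (lebesgue_tuple n')
  end.

Lemma lebesgue_tuple_box n (A : 'I_n -> set T) :
  (forall i, measurable (A i)) ->
  lebesgue_tuple n [set t | forall i, A i (tnth t i)] =
  (\prod_(i < n) lebesgue_measure (A i))%E.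
Proof.
elim: n A => [|n IHn] A mA.
  rewrite big_ord0 /= diracE mem_set//= => -[].
  by [].
rewrite big_ord_recl muleC -IHn//= /lebesgue_step /pushforward.
rewrite -product_measure1E//; last first.
  rewrite (_ : [set _ | _] =
    \bigcap_(i in [set: 'I_n]) (@tnth _ T ^~ i) @^-1` (A (lift ord0 i))).
    apply: fin_bigcap_measurable => // i _.
    by rewrite -[X in measurable X]setTI; exact: measurable_tnth.
  by apply/seteqP; split=> [t h i _|t h i]; [exact: h|exact: (h i)].
congr product_measure1; apply/seteqP; split => -[t x] /= h.
  split; first by move=> i; have := h (lift ord0 i); rewrite tnthS.
  exact: (h ord0).
case: h => h1 h2 i; have [j ->|->] := unliftP ord0 i; last exact: h2.
by rewrite tnthS; exact: h1.
Qed.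

End lebesgue.

Section domains.
Context {R : realType} {d : nat}.
Local Notation E := 'rV[R]_d.
Local Notation T := (measurableTypeR R).

(* [FlatTorus l] is R^d / (l_1 Z x ... x l_d Z); functions on it are encoded
   as periodic functions on R^d. *)
Inductive domain :=
| OpenDomain (Omega : set E) of open Omega
| FlatTorus (l : E) of (forall i, 0 < l ord0 i).

Implicit Types (D : domain) (f g u phi : E -> R).

Definition region D : set E :=
  match D with
  | OpenDomain Omega _ => Omega
  | FlatTorus l _ => [set x | forall i, 0 <= x ord0 i < l ord0 i]
  end.

Definition basis_vec (i : 'I_d) : E := delta_mx ord0 i.

Definition periodic (l : E) f :=
  forall i x, f (x + l ord0 i *: basis_vec i) = f x.

Definition on_domain D f :=
  match D with
  | OpenDomain _ _ => True
  | FlatTorus l _ => periodic l f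
  end.

Definition partial (i : 'I_d) f : E -> R := fun x => 'D_(basis_vec i) f x.

Definition smooth f :=
  forall s : seq 'I_d,
    continuous (foldr partial f s) /\
    forall i x, derivable (foldr partial f s) x (basis_vec i).

Definition test_function D phi :=
  smooth phi /\
  match D with
  | OpenDomain Omega _ =>
      exists K : set E, [/\ compact K, K `<=` Omega &
                            forall x, ~ K x -> phi x = 0]
  | FlatTorus l _ => periodic l phi
  end.

Definition row_of (t : d.-tuple T) : E := \row_i tnth t i.

Definition mregion D : set (d.-tuple T) := [set t | region D (row_of t)].

Definition dmeasurable D f := measurable_fun (mregion D) (f \o row_of).

Definition dintegrable D f :=
  (lebesgue_tuple d).-integrable (mregion D) (EFin \o f \o row_of).

Definition dintegral D f : R :=
  \int[lebesgue_tuple d]_(t in mregion D) f (row_of t).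

Definition dae D (P : E -> Prop) :=
  {ae lebesgue_tuple d, forall t, mregion D t -> P (row_of t)}.

Definition L2 D f := dmeasurable D f /\ dintegrable D (fun x => f x ^+ 2).

Definition weak_partial D (i : 'I_d) u g :=
  forall phi, test_function D phi ->
    dintegral D (fun x => u x * partial i phi x) =
    - dintegral D (fun x => g x * phi x).

Definition H1 D : set (E -> R) :=
  [set u | [/\ on_domain D u, L2 D u &
              forall i, exists g, L2 D g /\ weak_partial D i u g]].

(* [bc] is the set of functions obeying the boundary conditions. *)
Definition densities D (bc : set (E -> R)) (N : nat) : set (E -> R) :=
  [set rho | [/\ on_domain D rho, dae D (fun x => 0 <= rho x),
                 dintegrable D rho,
                 (H1 D `&` bc) (fun x => Num.sqrt (rho x)) &
                 dintegral D rho = N%:R]].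

(* [X] contains the set [I] of (classes modulo a.e. equality of) functions on
   [D]: a linear space of functions including [I] is identified, modulo a.e.
   equality, with a subspace of [X]. *)
Definition contains_functions D (X : lmodType R) (I : set (E -> R)) :=
  exists (S : set (E -> R)) (iota : (E -> R) -> X),
    [/\ I `<=` S,
        forall a f g, S f -> S g -> S (a *: f + g),
        forall a f g, S f -> S g -> iota (a *: f + g) = a *: iota f + iota g &
        forall f, S f -> (iota f = 0 <-> dae D (fun x => f x = 0))].

End domains.

Arguments domain : clear implicits.

(* Main.v *)
From HB Require Import structures.
Require Import Defs.
From mathcomp Require Import all_boot all_order all_algebra.
From mathcomp Require Import all_classical all_reals all_analysis.
From mathcomp Require Import ring lra.

Set Implicit Arguments.
Unset Strict Implicit.
Unset Printing Implicit Defensive.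

Import Order.TTheory GRing.Theory Num.Theory.
Import numFieldNormedType.Exports.

Local Open Scope classical_set_scope.
Local Open Scope ring_scope.

(** Let [s e] be the proximal point of [rho], and [v e] the duality map of
[(s e - rho) / e]. The optimality condition at the minimiser [s e] says
[- v e] is a subgradient of [F] at [s e] ([prox_set_subdifferential]).
Monotonicity of the subdifferential, tested against any subgradient [u] of [F]
at [rho], gives [`|v e| <= `|u|] and [`|s e - rho| <= e * `|u|]
([norm_prox_potential_le], [prox_cvg]). The [v e] are therefore bounded, so
along every ultrafilter refining [e --> 0^'+] they converge pointwise to some
[v] in the dual; since [s e --> rho] and [F] is lower semicontinuous, [- v] is
a subgradient at [rho], and it has the least norm among all subgradients
([prox_potential_ultra_cvg]). The subdifferential is convex and the dual
strictly convex, so this minimal element is unique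
([minimal_potential_unique]). All ultrafilter limits agree, hence [v e]
converges pointwise, and this is weak convergence by reflexivity.

The existence of [s e] is the direct method. An ultrafilter containing all
nonempty sublevel sets of [s |-> F s + `|s - rho| ^+ 2 / (2 * e)] has a weak
limit by reflexivity, the sublevel sets being bounded thanks to the affine
minorant of [F] that a subgradient provides. Closed convex sets are weakly
closed, so the limit lies in every sublevel set and minimises ([prox_exists]).

Separation of a point from a closed convex set, and nonemptiness of the
duality set, are both instances of one form of the Hahn-Banach theorem:
a Lipschitz convex function has a subgradient at every point
([convex_subgradient]), applied to the distance function and to the norm.
It is proved by Zorn's lemma: a minimal convex function vanishing at the
origin is linear ([minimal_convex_linear]).

In a Hilbert space the duality map is the linear isometry given by the inner
product. As [`|v e| <= `|v|] and [v e] converges weakly to [v], the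
parallelogram law makes the quotients Cauchy ([hilbert_cvg_of_weak_cvg]), and
the final estimate is the nonexpansiveness of [x |-> x - prox e F x]
([prox_potential_lipschitz]). *)

(** * Minimal convex functions and the Hahn-Banach theorem *)

Section convex_functions.
Context {R : realType} {V : lmodType R}.
Implicit Types (f g l p : V -> R) (P : set (V -> R)) (x y : V).

Definition convex_fun p := forall x y (t : R), 0 <= t <= 1 ->
  p (t *: x + (1 - t) *: y) <= t * p x + (1 - t) * p y.

(** For [P] of the form [{g i | i in I}] with [I] convex and [g] convex in
the pair [(i, x)], [h] is the member at the averaged index. A chain of convex
functions also qualifies, with [h] the smaller of [f] and [g]. *)
Definition jointly_convex P := forall f g x y (t : R),
  P f -> P g -> 0 <= t <= 1 ->
  exists2 h, P h & h (t *: x + (1 - t) *: y) <= t * f x + (1 - t) * g y.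

Definition inf_fun P x : R := inf [set f x | f in P].

Lemma inf_fun_le P x (b : R) f :
  (forall g, P g -> b <= g x) -> P f -> inf_fun P x <= f x.
Proof.
move=> bP Pf; apply: ge_inf; last by exists f.
by exists b => _ [g Pg <-]; exact: bP.
Qed.

Lemma inf_fun_ge P x (b : R) : P !=set0 ->
  (forall g, P g -> b <= g x) -> b <= inf_fun P x.
Proof.
move=> [f Pf] bP; apply: lb_le_inf; first by exists (f x); exists f.
by move=> _ [g Pg <-]; exact: bP.
Qed.

Lemma inf_fun_convex P : P !=set0 ->
  (forall x, exists b : R, forall g, P g -> b <= g x) ->
  jointly_convex P -> convex_fun (inf_fun P).
Proof.
move=> P0 bP cP x y t t01; apply/ler_addgt0Pr => e e0.
have hasinf z : has_inf [set f z | f in P].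
  split; first by have [f Pf] := P0; exists (f z); exists f.
  by have [b bz] := bP z; exists b => _ [g Pg <-]; exact: bz.
have [_ [f Pf <-] fx] := inf_adherent e0 (hasinf x).
have [_ [g Pg <-] gy] := inf_adherent e0 (hasinf y).
have [h Ph hle] := cP f g x y t Pf Pg t01.
have [b bz] := bP (t *: x + (1 - t) *: y).
apply: (le_trans (inf_fun_le bz Ph)); apply: (le_trans hle).
rewrite -/(inf_fun P x) in fx; rewrite -/(inf_fun P y) in gy.
by case/andP: t01 => t0 t1; nra.
Qed.

(** Convexity at the midpoint of [x] and [- x]. It bounds all convex
minorants of a function from below at once, which keeps the infimum of a chain
of them finite. *)
Lemma convex_fun_opp p : convex_fun p -> p 0 = 0 -> forall x, - p (- x) <= p x.
Proof.
move=> cp p0 x; have := cp x (- x) 2^-1.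
have -> : 2^-1 *: x + (1 - 2^-1) *: - x = 0.
  by rewrite (_ : 1 - 2^-1 = 2^-1 :> R); [rewrite scalerN subrr|field].
by rewrite p0 => /(_ ltac:(lra)); lra.
Qed.

(** Minimality is asked among convex, not sublinear, functions: positive
homogeneity then follows from minimality, so no directional derivative is
needed to start from a convex function. *)
Definition minimal_convex l := [/\ convex_fun l, l 0 = 0 &
  forall m, convex_fun m -> m 0 = 0 -> (forall x, m x <= l x) -> m = l].

Lemma minimal_convex_below p : convex_fun p -> p 0 = 0 ->
  exists2 l, minimal_convex l & forall x, l x <= p x.
Proof.
move=> cp p0.
pose Q l := [/\ convex_fun l, l 0 = 0 & forall x, l x <= p x].
pose S : Type := {l | Q l}.
pose leS (a b : S) := `[< forall x, sval b x <= sval a x >].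
have [| | | |[l [cl l0 lp]] lmin] := @Zorn S leS.
- by move=> a; apply/asboolP.
- move=> a b c /asboolP ab /asboolP bc; apply/asboolP => x.
  exact: le_trans (ab x).
- move=> [a Qa] [b Qb] /asboolP/= ab /asboolP/= ba; apply: eq_exist.
  by apply/funext => x; apply/eqP; rewrite eq_le ab ba.
- move=> A totA; have [[a0 Aa0]|A0] := pselect (A !=set0); last first.
    have Qp : Q p by [].
    by exists (exist _ p Qp) => s As; exfalso; apply: A0; exists s.
  (* The pointwise infimum of a chain bounds it. *)
  pose P := [set sval a | a in A].
  have P0 : P !=set0 by exists (sval a0); exists a0.
  have bP x : forall g, P g -> - p (- x) <= g x.
    move=> _ [[g [cg g0 gp]] /= _ <-].
    by apply: le_trans (convex_fun_opp cg g0 x); rewrite lerN2.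
  have Qm : Q (inf_fun P).
    split.
    - apply: inf_fun_convex => //; first by move=> x; eexists; exact: bP.
      move=> f g x y t Pf Pg /andP[t0 t1].
      have [h [Ph hf hg]] : exists h, [/\ P h, forall z, h z <= f z &
                                             forall z, h z <= g z].
        case: Pf Pg => a Aa <- [b Ab <-].
        have [/asboolP ab|/asboolP ba] := totA _ _ Aa Ab.
          by exists (sval b); split => //; exists b.
        by exists (sval a); split => //; exists a.
      exists h => //; have [c _ ch] := Ph.
      have [chh _ _] := svalP c; rewrite ch in chh.
      apply: le_trans (chh x y t _) _; first exact/andP.
      by apply: lerD; apply: ler_wpM2l => //; rewrite subr_ge0.
    - apply/eqP; rewrite eq_le; apply/andP; split.
        case: P0 => f Pf; rewrite (le_trans (inf_fun_le (bP 0) Pf))//.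
        by case: Pf => [[g [cg g0 gp]] /= _ <-]; rewrite g0.
      apply: inf_fun_ge => // f [[g [cg g0 gp]] /= _ <-]; by rewrite g0.
    - move=> x; case: (P0) => f Pf; rewrite (le_trans (inf_fun_le (bP x) Pf))//.
      by case: Pf => [[g [cg g0 gp]] /= _ <-].
  exists (exist _ _ Qm) => s As; apply/asboolP => x /=.
  by apply: inf_fun_le (bP x) _; exists s.
- exists l => //; split=> // m cm m0 ml.
  have Qm : Q m by split=> // x; exact: le_trans (lp x).
  by have /(_ ltac:(exact/asboolP))/(congr1 sval) := lmin (exist _ m Qm).
Qed.

(** For [0 < a <= 1], [y |-> a^-1 * l (a *: y)] is again convex, vanishes at
[0] and lies below [l], so minimality forces equality. *)
Lemma minimal_convexZ l : minimal_convex l ->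
  forall (a : R) x, 0 < a -> l (a *: x) = a * l x.
Proof.
move=> [cl l0 lmin].
have small (a : R) x : 0 < a -> a <= 1 -> l (a *: x) = a * l x.
  move=> a0 a1; have -> : l x = a^-1 * l (a *: x); last first.
    by rewrite mulVKf// gt_eqF.
  have cx y : l (a *: y) <= a * l y.
    have := cl y 0 a; rewrite scaler0 addr0 l0 mulr0 addr0; apply.
    by rewrite (ltW a0).
  apply: esym; apply: (congr1 (@^~ x) (lmin (fun y => a^-1 * l (a *: y)) _ _ _)).
  - move=> y z t t01 /=; rewrite scalerDr !scalerA !(mulrC a) -!scalerA.
    rewrite [t * (_ * _)]mulrCA [(1 - t) * (_ * _)]mulrCA -mulrDr.
    by rewrite ler_pM2l ?invr_gt0//; exact: cl.
  - by rewrite scaler0 l0 mulr0.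
  - by move=> y; rewrite ler_pdivrMl.
move=> a x a0; have [/small->//|a1] := leP a 1.
rewrite -[in RHS](scale1r x) -(mulVf (lt0r_neq0 a0)) -scalerA (small a^-1).
- by rewrite mulrA divff ?mul1r// gt_eqF.
- by rewrite invr_gt0.
- by rewrite invf_le1// ltW.
Qed.

(** Once [l] is positively homogeneous it is subadditive. For superadditivity
in the direction [a], the function [x |-> inf_(t >= 0) (l (x + t a) - t l a)]
is a convex competitor below [l]; it equals [l], and [t = 1] gives
[l x + l a <= l (x + a)]. *)
Lemma minimal_convex_linear l : minimal_convex l ->
  linear (l : V -> R^o).
Proof.
move=> lm; have [cl l0 lmin] := lm; have lZ := minimal_convexZ lm.
have subadd x y : l (x + y) <= l x + l y.
  have := cl (2 *: x) (2 *: y) 2^-1 ltac:(lra).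
  rewrite (_ : 1 - 2^-1 = 2^-1 :> R); last by field.
  by rewrite !scalerA mulVf// !scale1r !lZ//; lra.
have superadd a x : l x + l a <= l (x + a).
  pose P := [set (fun x => l (x + t *: a) - t * l a) | t in [set t : R | 0 <= t]].
  have lZ0 t y : 0 <= t -> l (t *: y) = t * l y.
    rewrite le_eqVlt => /predU1P[<-|/lZ//]; by rewrite scale0r mul0r.
  have bP y : forall g, P g -> - l (- y) <= g y.
    move=> _ [t /= t0 <-]; rewrite -lZ0//.
    have := subadd (y + t *: a) (- y).
    by rewrite addrAC subrr add0r; lra.
  have Pt t : 0 <= t -> P (fun x => l (x + t *: a) - t * l a) by exists t.
  have PleP t y : 0 <= t -> inf_fun P y <= l (y + t *: a) - t * l a.
    by move=> /Pt; exact: (inf_fun_le (bP y)).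
  have Ple y : inf_fun P y <= l y.
    by have := PleP 0 y (lexx _); rewrite scale0r mul0r addr0 subr0.
  have mE : inf_fun P = l.
    apply: lmin => //.
    - apply: inf_fun_convex.
      + by eexists; apply: (Pt 0).
      + by move=> y; eexists; exact: bP.
      + move=> _ _ y z t [r /= r0 <-] [s /= s0 <-] /andP[t0 t1].
        exists (fun x => l (x + (t * r + (1 - t) * s) *: a) -
                         (t * r + (1 - t) * s) * l a).
          by apply: Pt; rewrite addr_ge0// mulr_ge0// subr_ge0.
        have := cl (y + r *: a) (z + s *: a) t ltac:(exact/andP).
        rewrite !scalerDr !scalerA addrACA -scalerDl.
        lra.
    - apply/eqP; rewrite eq_le -{1}l0 Ple/=.
      apply: inf_fun_ge => [|g /(bP 0)]; first by eexists; apply: (Pt 0).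
      by rewrite oppr0 l0 oppr0.
  have := PleP 1 x ler01; rewrite mE scale1r mul1r; lra.
have lD x y : l (x + y) = l x + l y.
  by apply/eqP; rewrite eq_le subadd superadd.
have lN x : l (- x) = - l x.
  by apply/eqP; rewrite -addr_eq0 -lD addNr l0.
move=> k x y; rewrite lD; congr (_ + _).
have [k0|k0|->] := ltgtP k 0; last by rewrite !scale0r l0.
- by rewrite -[k]opprK scaleNr lN lZ ?oppr_gt0// scaleNr.
- exact: lZ.
Qed.

Lemma hahn_banach p : convex_fun p -> p 0 = 0 ->
  exists2 l : V -> R, linear (l : V -> R^o) & forall x, l x <= p x.
Proof.
move=> cp p0; have [l /minimal_convex_linear ll lp] := minimal_convex_below cp p0.
by exists l.
Qed.

End convex_functions.

(** * Subgradients and separation in normed spaces *)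

Section normed_space.
Context {R : realType} {V : normedModType R}.
Implicit Types (x y z : V) (u w : dual V).

Lemma dual_ub u x : `|u x| <= `|u| * `|x|.
Proof. exact: dual_norm_ub. Qed.

Lemma dualB u x y : u (x - y) = u x - u y.
Proof. exact: linearB. Qed.

Lemma dualN u x : u (- x) = - u x.
Proof. exact: linearN. Qed.

Lemma dualD u x y : u (x + y) = u x + u y.
Proof. exact: linearD. Qed.

Lemma dualZ u (a : R) x : u (a *: x) = a * u x.
Proof. exact: linearZ. Qed.

Lemma dualNE u x : (- u) x = - u x.
Proof. by []. Qed.

Lemma bounded_linear_dual (l : V -> R) (M : R) : 0 <= M ->
  linear (l : V -> R^o) -> (forall x, `|l x| <= M * `|x|) ->
  exists2 u : dual V, (forall x, u x = l x) & `|u| <= M.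
Proof.
move=> M0 ll lM.
pose L := GRing.isLinear.Build R V R^o *:%R l ll.
pose lin : {linear V -> R^o} := HB.pack (l : V -> R^o) L.
have lc : continuous (l : V -> R^o).
  apply: (@bounded_linear_continuous R V R^o lin).
  apply/linear_boundedP; apply: filterS (nbhs_pinfty_ge (num_real M)) => r Mr x.
  by apply: (le_trans (lM x)); rewrite ler_wpM2r.
have lP : (l : V -> R^o) \in dual_pred (X:=V) by apply/asboolP.
exists (Dual lP) => //; rewrite dual_normE; exact: dual_norm_le.
Qed.

(** The linear function given by [hahn_banach] below the increments
[h |-> p (x + h) - p x] is bounded by the Lipschitz constant. *)
Lemma convex_subgradient (p : V -> R) (L : R) x : 0 <= L -> convex_fun p ->
  (forall y z, p y - p z <= L * `|y - z|) ->
  exists2 u : dual V, `|u| <= L & forall y, p x + u (y - x) <= p y.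
Proof.
move=> L0 cp pL.
have [|| l ll lp] := @hahn_banach R V (fun h => p (x + h) - p x).
- move=> y z t t01.
  have := cp (x + y) (x + z) t t01.
  have -> : t *: (x + y) + (1 - t) *: (x + z) = x + (t *: y + (1 - t) *: z).
    by rewrite !scalerDr addrACA -scalerDl (addrC t) subrK scale1r.
  lra.
- by rewrite addr0 subrr.
have lN h : l (- h) = - l h.
  have l0 : l 0 = 0 by have := ll (-1) 0 0; rewrite !scaleN1r !addNr.
  by have := ll (-1) h 0; rewrite !scaleN1r l0 !addr0.
have ub h : l h <= L * `|h|.
  by rewrite (le_trans (lp h))// (le_trans (pL _ _))// addrC addKr.
have [|u ul uL] := bounded_linear_dual L0 ll.
  move=> h; rewrite ler_norml ub andbT lerNl -lN.
  by rewrite (le_trans (ub _))// normrN.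
by exists u => // y; rewrite ul; have := lp (y - x); rewrite [x + _]addrC subrK; lra.
Qed.

(** The separating functional is a subgradient at [z] of the distance to
[C], which is convex, 1-Lipschitz, zero on [C] and positive at [z]. *)
Lemma closed_convex_separation (C : set V) z : C !=set0 -> closed C ->
  (forall x y (t : R), C x -> C y -> 0 <= t <= 1 ->
     C (t *: x + (1 - t) *: y)) -> ~ C z ->
  exists u : dual V, exists2 e : R, 0 < e & forall c, C c -> u c <= u z - e.
Proof.
move=> C0 clC cC nCz.
pose P := [set (fun x => `|x - c|) | c in C].
have bP x : forall g, P g -> 0 <= g x by move=> _ [c _ <-].
have P0 : P !=set0 by case: C0 => c Cc; eexists; exists c; first exact: Cc.
have dle x c : C c -> inf_fun P x <= `|x - c|.
  by move=> Cc; apply: (inf_fun_le (f := fun y => `|y - c|) (bP x)); exists c.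
have [e e0 ed] : exists2 e : R, 0 < e & e <= inf_fun P z.
  have /nbhs_ballP[e /= e0 ez] : nbhs z (~` C).
    by apply: (@open_nbhs_nbhs V z); split => //; exact: closed_openC.
  exists e => //; apply: inf_fun_ge => // _ [c Cc <-].
  rewrite leNgt; apply/negP => zc; apply: (ez c) => //.
  by rewrite -ball_normE.
have [||u _ uP] := @convex_subgradient (inf_fun P) 1 z ler01.
- apply: inf_fun_convex => //; first by move=> x; exists 0; exact: bP.
  move=> _ _ x y t [c Cc <-] [c' Cc' <-] t01.
  exists (fun x => `|x - (t *: c + (1 - t) *: c')|).
    by eexists; first exact: (cC c c' t Cc Cc').
  rewrite opprD addrACA -!scalerBr; case/andP: t01 => t0 t1.
  apply: (le_trans (ler_normD _ _)); rewrite !normrZ (ger0_norm t0) ger0_norm//.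
  by rewrite subr_ge0.
- move=> x y; rewrite mul1r lerBlDr -lerBlDl.
  apply: inf_fun_ge => // _ [c Cc <-]; rewrite lerBlDl.
  apply: (le_trans (dle x c Cc)).
  by rewrite -{1}(subrK y x) -addrA ler_normD.
exists u, e => // c Cc; have := uP c; rewrite dualB.
have : inf_fun P c <= 0 by rewrite (le_trans (dle c c Cc))// subrr normr0.
lra.
Qed.

End normed_space.

(** * Weak limits along ultrafilters *)

Section ultrafilters.
Context {R : realType}.

(** If [f^-1(A)] is not in [F] for some neighbourhood [A] of [y], then [F]
and the complement of [f^-1(A)] generate a proper filter, and an ultrafilter
refining it contradicts the hypothesis. *)
Lemma cvg_ultra {T : Type} {Y : topologicalType} (F : set_system T)
    (f : T -> Y) (y : Y) : ProperFilter F ->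
  (forall U, UltraFilter U -> F `<=` U -> f @ U --> y) -> f @ F --> y.
Proof.
move=> FF fU A Ay; suff : F (f @^-1` A) by []; apply: contrapT => nFA.
pose G := filter_from F (fun B => B `&` ~` (f @^-1` A)).
have GF : ProperFilter G.
  apply: filter_from_proper.
    apply: filter_from_filter; first by exists setT; exact: filterT.
    move=> B C FB FC; exists (B `&` C); first exact: filterI.
    by rewrite setIACA setIid.
  move=> B FB; apply: contrapT => B0; apply: nFA.
  apply: filterS FB => t Bt /=; apply: contrapT => nA.
  by apply: B0; exists t.
have [U [UU GU]] := ultraFilterLemma GF.
have FU : F `<=` U.
  by move=> B FB; apply: GU; exists B => // t [].
have UnA : U (~` (f @^-1` A)).
  by apply: GU; exists setT; [exact: filterT|move=> t []].
have UA : U (f @^-1` A) by exact: (fU U UU FU A Ay).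
by have [t []] := filter_ex (filterI UA UnA).
Qed.

Lemma bounded_ultra_cvg {T : Type} (U : set_system T) (f : T -> R) (M : R) :
  UltraFilter U -> (\forall t \near U, `|f t| <= M) ->
  exists l : R, f @ U --> l.
Proof.
move=> UU fM.
have [l [_ lcl]] : (`[- M, M]%classic `&` cluster (f @ U)) !=set0.
  apply: segment_compact; apply: filterS fM => t /=.
  by rewrite ler_norml in_itv.
exists l => A Al; have [//|UnA] := in_ultra_setVsetC (f @^-1` A) UU.
by have [r []] := lcl (~` A) A UnA Al.
Qed.

(** The ultrafilter picks a limit for all evaluations at once, and these
limits depend linearly on the point. This plays the role of the weak-star
compactness of balls without any appeal to product topologies. *)
Lemma dual_ultra_cvg {T : Type} {V : normedModType R} (U : set_system T)
    (u : T -> dual V) (M : R) :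
  UltraFilter U -> 0 <= M -> (\forall t \near U, `|u t| <= M) ->
  exists2 w : dual V, `|w| <= M & forall x, u t x @[t --> U] --> (w x : R).
Proof.
move=> UU M0 uM.
have uxM x : \forall t \near U, `|u t x| <= M * `|x|.
  by apply: filterS uM => t ut; rewrite (le_trans (dual_ub _ _))// ler_wpM2r.
have /choice[l lP] x : exists l : R, u t x @[t --> U] --> l.
  exact: (bounded_ultra_cvg UU (uxM x)).
have ll : linear (l : V -> R^o).
  move=> a x y; apply: (@norm_cvg_unique R R^o _ _ _ _ (lP _)).
  rewrite (_ : (fun t => u t (a *: x + y)) = fun t => a * u t x + u t y).
    by apply: cvgD => //; apply: cvgM => //; exact: cvg_cst.
  by apply/funext => t; rewrite linearP.
have [|w wl wM] := bounded_linear_dual M0 ll.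
  by move=> x; apply: (cvgr_to_le (cvg_norm (lP x))).
by exists w => // x; rewrite wl.
Qed.

Context {X : normedModType R}.
Hypothesis Xr : reflexive_space X.

(** The previous lemma in the bidual, whose elements are evaluations. *)
Lemma reflexive_ultra_cvg {T : Type} (U : set_system T) (x : T -> X) (M : R) :
  UltraFilter U -> 0 <= M -> (\forall t \near U, `|x t| <= M) ->
  exists z, forall u : dual X, u (x t) @[t --> U] --> (u z : R).
Proof.
move=> UU M0 xM.
have /choice[ev evP] t : exists e : dual (dual X),
    (forall u : dual X, e u = u (x t)) /\ `|e| <= `|x t|.
  have [||e] := @bounded_linear_dual R (dual X) (fun u => u (x t)) _ (normr_ge0 (x t)).
  - by move=> a u w; rewrite dualDE dualZE.
  - by move=> u; rewrite mulrC dual_ub.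
  by exists e.
have [|phi _ phiP] := @dual_ultra_cvg T (dual X) U ev M UU M0.
  by apply: filterS xM => t; apply: le_trans; case: (evP t).
have [z zP] := Xr phi; exists z => u; rewrite -zP.
have := phiP u; rewrite (_ : (fun t => ev t u) = (fun t => u (x t)))//.
by apply/funext => t; case: (evP t).
Qed.

End ultrafilters.

Lemma closed_convex_weakly_closed {R : realType} {X : normedModType R}
    {T : Type} (U : set_system T) (x : T -> X) z (C : set X) :
  UltraFilter U -> closed C ->
  (forall x y (t : R), C x -> C y -> 0 <= t <= 1 ->
     C (t *: x + (1 - t) *: y)) ->
  (forall u : dual X, u (x t) @[t --> U] --> (u z : R)) ->
  (\forall t \near U, C (x t)) -> C z.
Proof.
move=> UU clC cC xz UC; apply: contrapT => nCz.
have C0 : C !=set0 by have [t Ct] := filter_ex UC; exists (x t).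
have [u [e e0 ue]] := closed_convex_separation C0 clC cC nCz.
have : u z <= u z - e.
  by apply: (cvgr_to_le (xz u)); apply: filterS UC => t; exact: ue.
lra.
Qed.

(** * The duality map *)

(** The form in which strict convexity is used: both vectors must have norm
exactly [r], and can then be rescaled to the unit sphere. It yields uniqueness
of the duality map and of the subgradient of least norm. *)
Lemma strictly_convex_midpoint_eq {R : realType} (Y : normedModType R)
    (x y : Y) (r : R) : strictly_convex Y ->
  `|x| <= r -> `|y| <= r -> r <= `|2^-1 *: (x + y)| -> x = y.
Proof.
move=> Ys xr yr; rewrite normrZ ger0_norm ?invr_ge0// => rxy.
have xyD := ler_normD x y.
have nx : `|x| = r by lra.
have ny : `|y| = r by lra.
have [r0|r0] := eqVneq r 0.
  by rewrite (normr0_eq0 (etrans nx r0)) (normr0_eq0 (etrans ny r0)).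
have rp : 0 < r by rewrite lt_neqAle eq_sym r0 -nx normr_ge0.
apply: contrapT => /eqP xy.
have nZ (z : Y) : `|z| = r -> `|r^-1 *: z| = 1.
  by move=> zr; rewrite normrZ zr normfV gtr0_norm// mulVf.
have := Ys _ _ (nZ _ nx) (nZ _ ny).
rewrite (inj_eq (scalerI _)) ?invr_neq0// => /(_ xy).
rewrite -scalerDr scalerA mulrC -scalerA normrZ normfV (gtr0_norm rp).
rewrite mulrC ltr_pdivrMr// mul1r normrZ ger0_norm ?invr_ge0//.
by rewrite ltNge rxy.
Qed.

Section duality_map.
Context {R : realType} {X : normedModType R}.
Implicit Types (x y : X) (u w : dual X).

Lemma dual_le u x : u x <= `|u| * `|x|.
Proof. exact: le_trans (ler_norm _) (dual_ub u x). Qed.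

(** The two inequalities, unlike the equalities defining the duality set,
pass to weak limits; the reverse ones hold by [dual_le]. *)
Lemma duality_setP x u :
  duality_set x u <-> `|u| <= `|x| /\ `|x| ^+ 2 <= u x.
Proof.
split=> [[ux xu]|[ux xu]].
  rewrite ux; split=> //.
  by move/eqP: xu; rewrite eqrXn2// => /eqP ->.
have := dual_le u x; have := normr_ge0 x; have := normr_ge0 u.
move=> u0 x0 uxx; have uE : `|u| = `|x|.
  have [x1|x1] := eqVneq `|x| 0; first by rewrite x1 in ux *; lra.
  have xp : 0 < `|x| by rewrite lt_neqAle eq_sym x1.
  apply/eqP; rewrite eq_le ux -(ler_pM2r xp) -expr2.
  exact: le_trans uxx.
split; last by rewrite uE.
by apply/eqP; rewrite eq_le xu andbT (le_trans uxx)// uE -expr2.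
Qed.

(** A subgradient [u] of the norm at [x] satisfies [`|u| <= 1] and
[`|x| <= u x]; rescale it by [`|x|]. *)
Lemma duality_set_nonempty x : duality_set x !=set0.
Proof.
have [||u u1 ux] := @convex_subgradient R X (fun y => `|y|) 1 x ler01.
- move=> y z t /andP[t0 t1]; apply: (le_trans (ler_normD _ _)).
  by rewrite !normrZ (ger0_norm t0) ger0_norm// subr_ge0.
- by move=> y z; rewrite mul1r lerB_dist.
exists (`|x| *: u); apply/duality_setP; split.
  by rewrite normrZ normr_id ler_piMr.
rewrite dualZE expr2 ler_wpM2l//.
by have := ux 0; rewrite sub0r linearN normr0; lra.
Qed.

Lemma duality_map_set x : duality_set x (duality_map x).
Proof. by have [u ux] := duality_set_nonempty x; exact: (xgetI 0 ux). Qed.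

Lemma duality_mapxx x : duality_map x x = `|x| ^+ 2.
Proof. by case: (duality_map_set x). Qed.

Lemma norm_duality_map x : `|duality_map x| = `|x|.
Proof.
have [_ /eqP] := duality_map_set x.
by rewrite eqrXn2// => /eqP.
Qed.

(** The duality map is a subgradient of half the squared norm. *)
Lemma duality_map_subgradient x y :
  2 * duality_map x (y - x) <= `|y| ^+ 2 - `|x| ^+ 2.
Proof.
rewrite dualB duality_mapxx; have := dual_le (duality_map x) y.
rewrite norm_duality_map; have := sqr_ge0 (`|x| - `|y|); nra.
Qed.

Hypothesis dualX_strict : strictly_convex (dual X).

Lemma duality_map_eq x u : duality_set x u -> duality_map x = u.
Proof.
move=> /duality_setP[ux xu].
have /duality_setP[wx xw] := duality_map_set x.
apply: (strictly_convex_midpoint_eq dualX_strict wx ux).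
have [x0|x0] := eqVneq `|x| 0; first by rewrite x0.
have xp : 0 < `|x| by rewrite lt_neqAle eq_sym x0 normr_ge0.
rewrite -(ler_pM2r xp) (le_trans _ (dual_le _ _))//.
by rewrite dualZE dualDE -expr2; lra.
Qed.

Lemma duality_mapZ (a : R) x : 0 < a ->
  duality_map (a *: x) = a *: duality_map x.
Proof.
move=> a0; apply/duality_map_eq/duality_setP.
rewrite !normrZ norm_duality_map; split=> //.
by rewrite dualZE dualZ duality_mapxx gtr0_norm//; lra.
Qed.

(** Along an ultrafilter the bounded functionals [duality_map (z t)] have a
limit [w], and the inequalities of [duality_setP] survive in the limit, so [w]
belongs to the duality set of [x]; that set is a singleton. *)
Lemma duality_map_demicontinuous {T : Type} (F : set_system T) (z : T -> X) x y :
  ProperFilter F -> z @ F --> x ->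
  duality_map (z t) y @[t --> F] --> (duality_map x y : R).
Proof.
move=> FF zx; apply: cvg_ultra => U UU FU.
have {}zx : z @ U --> x by apply: cvg_trans zx => A; exact: FU.
have nz : `|z t| @[t --> U] --> (`|x| : R) by exact: cvg_norm.
have [||w _ wP] := @dual_ultra_cvg R T X U (fun t => duality_map (z t)) (`|x| + 1) UU.
- by rewrite addr_ge0.
- have := cvgr_le _ nz (`|x| + 1) ltac:(lra).
  by apply: filterS => t; rewrite norm_duality_map.
suff /duality_map_eq -> : duality_set x w by exact: wP.
apply/duality_setP; split.
  apply: dual_norm_le => // h.
  rewrite -subr_ge0.
  apply: (@cvgr_to_ge _ U _ R (fun t => `|z t| * `|h| - `|duality_map (z t) h|)).
    apply: cvgB; last exact: cvg_norm.
    by apply: cvgM => //; exact: cvg_cst.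
  apply: nearW => t; rewrite subr_ge0.
  by rewrite (le_trans (dual_ub _ _))// norm_duality_map.
rewrite -subr_ge0.
(* The subtracted term is a lower bound of [duality_map (z t) x], because
   [x = z t + (x - z t)]. *)
have lim : duality_map (z t) x - (`|z t| ^+ 2 - `|z t| * `|x - z t|)
    @[t --> U] --> (w x - (`|x| ^+ 2 - `|x| * `|x - x|) : R).
  apply: cvgB => //; apply: cvgB.
    rewrite expr2 (_ : (fun t => `|z t| ^+ 2) = (fun t => `|z t| * `|z t|)).
      exact: cvgM.
    by apply/funext => t; rewrite expr2.
  apply: cvgM => //; apply: cvg_norm; apply: cvgB => //; exact: cvg_cst.
rewrite subrr normr0 mulr0 subr0 in lim.
apply: (cvgr_to_ge lim); apply: nearW => t.
have := dual_ub (duality_map (z t)) (x - z t).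
by rewrite norm_duality_map ler_norml dualB duality_mapxx => /andP[]; lra.
Qed.

End duality_map.

(** * Proximal points *)

Section prox.
Context {R : realType} {X : normedModType R}.
Variable F : X -> \bar R.
Hypotheses (F_proper : proper_fun F) (F_convex : convex_efun F).
Implicit Types (x y s : X) (u w : dual X) (e : R).

Lemma proper_finE x : (F x < +oo)%E -> exists r : R, F x = r%:E.
Proof.
by have := (F_proper.1 x); case: (F x) => // r _ _; exists r.
Qed.

Lemma subdifferential_fin x u : subdifferential F x u ->
  exists r : R, F x = r%:E.
Proof.
move=> xu; apply: proper_finE; have [y yoo] := F_proper.2.
rewrite ltey; apply/eqP => Fx.
by have := xu y; rewrite Fx addye// leye_eq => /eqP Fy; rewrite Fy in yoo.
Qed.

(** Add the two subgradient inequalities; the values of [F] cancel because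
they are finite. *)
Lemma subdifferential_monotone x y u w :
  subdifferential F x u -> subdifferential F y w -> 0 <= (u - w) (x - y).
Proof.
move=> xu yw.
have [fx Fx] := subdifferential_fin xu; have [fy Fy] := subdifferential_fin yw.
have := xu y; have := yw x; rewrite Fx Fy -!EFinD !lee_fin.
rewrite dualDE dualNE -(opprB x y) !dualN; lra.
Qed.

(** The convexity of [F] with finite values, extended to [t = 0] and [t = 1],
where the hypothesis on [F] says nothing. *)
Lemma convex_efun_fin x y (t : R) (fx fy : R) : 0 <= t <= 1 ->
  F x = fx%:E -> F y = fy%:E ->
  exists2 r, F (t *: x + (1 - t) *: y) = r%:E & r <= t * fx + (1 - t) * fy.
Proof.
move=> /andP[]; rewrite le_eqVlt => /predU1P[<- _ _ Fy|t0].
  by exists fy; rewrite ?scale0r ?add0r ?subr0 ?scale1r//; lra.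
rewrite le_eqVlt => /predU1P[-> Fx _|t1 Fx Fy].
  by exists fx; rewrite ?scale1r ?subrr ?scale0r ?addr0//; lra.
have := F_convex x y t0 t1; rewrite Fx Fy -!EFinM -EFinD => Fle.
have [r Fr] := proper_finE (le_lt_trans Fle (ltry _)).
by exists r => //; rewrite Fr lee_fin in Fle.
Qed.

Lemma sqr_norm_convex x y (t : R) : 0 <= t <= 1 ->
  `|t *: x + (1 - t) *: y| ^+ 2 <= t * `|x| ^+ 2 + (1 - t) * `|y| ^+ 2.
Proof.
move=> /andP[t0 t1]; have := ler_normD (t *: x) ((1 - t) *: y).
have t1' : 0 <= 1 - t by rewrite subr_ge0.
rewrite !normrZ (ger0_norm t0) (ger0_norm t1') => le1.
apply: (@le_trans _ _ ((t * `|x| + (1 - t) * `|y|) ^+ 2)).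
  by rewrite ler_sqr// nnegrE// addr_ge0// mulr_ge0.
have := mulr_ge0 (mulr_ge0 t0 t1') (sqr_ge0 (`|x| - `|y|)); nra.
Qed.

Section existence.
Hypothesis X_reflexive : reflexive_space X.
Hypothesis F_lsc : lower_semicontinuous F.
Variables (x : X) (e : R).
Hypothesis e0 : 0 < e.

Let g s := (F s + ((2 * e)^-1 * `|s - x| ^+ 2)%:E)%E.
Let c : R := (2 * e)^-1.

Let c0 : 0 < c. Proof. by rewrite invr_gt0 mulr_gt0. Qed.

Let gleP s (a : R) : (g s <= a%:E)%E ->
  exists2 fs : R, F s = fs%:E & fs + c * `|s - x| ^+ 2 <= a.
Proof.
rewrite /g => ga; have [|fs Fs] := @proper_finE s.
  by rewrite ltey; apply/eqP => Fs; move: ga; rewrite Fs addye.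
by exists fs => //; rewrite Fs -EFinD lee_fin in ga.
Qed.

Lemma prox_sublevel_closed (a : R) : closed [set s | (g s <= a%:E)%E].
Proof.
rewrite -openC openE => s /= /negP; rewrite -ltNge => ags.
have [b sb bF] : exists2 b, a - c * `|s - x| ^+ 2 < b & (b%:E < F s)%E.
  move: ags; rewrite /g; have := F_proper.1 s; case: (F s) => // [r|] _.
    rewrite -EFinD lte_fin -/c => ar.
    by exists ((a - c * `|s - x| ^+ 2 + r) / 2); rewrite ?lte_fin; lra.
  by move=> _; exists (a - c * `|s - x| ^+ 2 + 1); rewrite ?ltry//; lra.
have [V sV VF] := F_lsc bF.
have nc : c * `|s' - x| ^+ 2 @[s' --> s] --> (c * `|s - x| ^+ 2 : R).
  apply: cvgM; first exact: cvg_cst.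
  rewrite expr2 (_ : (fun t => `|t - x| ^+ 2) = (fun t => `|t - x| * `|t - x|)).
    by apply: cvgM; apply: cvg_norm; apply: cvgB => //; exact: cvg_cst.
  by apply/funext => t; rewrite expr2.
have nb := cvgr_gt _ nc (a - b) ltac:(lra).
apply: filterS (filterI sV nb) => s' [/VF bF' /= ab].
apply/negP; rewrite -ltNge /g -/c.
move: bF'; have := F_proper.1 s'; case: (F s') => // [r|] _.
  by rewrite -EFinD !lte_fin; lra.
by rewrite addye// !ltry.
Qed.

Lemma prox_sublevel_convex (a : R) s s' (t : R) :
  (g s <= a%:E)%E -> (g s' <= a%:E)%E -> 0 <= t <= 1 ->
  (g (t *: s + (1 - t) *: s')%R <= a%:E)%E.
Proof.
move=> /gleP[fs Fs sa] /gleP[fs' Fs' s'a] t01.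
have [r Fr rle] := convex_efun_fin t01 Fs Fs'.
rewrite /g Fr -EFinD lee_fin -/c.
have := sqr_norm_convex (s - x) (s' - x) t01.
have -> : t *: (s - x) + (1 - t) *: (s' - x) = t *: s + (1 - t) *: s' - x.
  by rewrite !scalerBr addrACA -opprD -scalerDl (addrC t) subrK scale1r.
move=> /(ler_wpM2l (ltW c0)).
case/andP: t01 => t0 t1.
have := ler_wpM2l t0 sa; have := ler_wpM2l (_ : 0 <= 1 - t) s'a.
rewrite subr_ge0 => /(_ t1).
lra.
Qed.

(** The affine minorant given by [u] grows at most linearly, so the
quadratic term wins. *)
Lemma prox_sublevel_bounded x0 u (a : R) : subdifferential F x0 u ->
  exists2 M : R, 0 <= M & forall s, (g s <= a%:E)%E -> `|s| <= M.
Proof.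
move=> xu; have [f0 F0] := subdifferential_fin xu.
(* Beyond distance [M0], [c * n ^+ 2] exceeds [`|u| * n + K]: the summand [1]
   ensures [n > 1], which lets [K * n] absorb [K]. *)
pose K := `|a - f0 - u (x - x0)|.
pose M0 := 1 + (`|u| + K) / c.
have K0 : 0 <= K by exact: normr_ge0.
have Kc : 0 <= (`|u| + K) / c by rewrite divr_ge0 ?(ltW c0)// addr_ge0.
have M0ge : 0 <= M0 by rewrite addr_ge0.
exists (M0 + `|x|); first by rewrite addr_ge0.
move=> s /gleP[fs Fs sa].
have -> : s = (s - x) + x by rewrite subrK.
rewrite (le_trans (ler_normD _ _))// lerD2r leNgt; apply/negP => Ms.
have := xu s; rewrite F0 Fs -EFinD lee_fin.
rewrite -(subrK x s) -addrA dualD.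
have := dual_ub u (s - x); rewrite ler_norml => /andP[us _].
have n1 : 1 < `|s - x|.
  by apply: le_lt_trans Ms; rewrite lerDl.
have cn : `|u| + K < c * `|s - x|.
  rewrite -ltr_pdivrMl// mulrC; apply: le_lt_trans Ms; rewrite /M0; lra.
have Kge := ler_norm (a - f0 - u (x - x0)); rewrite -/K in Kge.
have : K + `|u| * `|s - x| < c * `|s - x| ^+ 2 by nra.
lra.
Qed.

(** The sublevel sets [B s'] through points of the domain are totally ordered
by inclusion, so they generate a filter; a weak limit along an ultrafilter
refining it stays in each [B s'], that is, has a value below every [g s']. *)
Lemma prox_exists x0 u : subdifferential F x0 u -> prox_set e F x !=set0.
Proof.
move=> xu.
pose D := [set s | (F s < +oo)%E].
pose B s' := [set s | (g s <= g s')%E].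
have gfin s' : D s' -> exists a : R, g s' = a%:E.
  by move=> /proper_finE[r Fr]; eexists; rewrite /g Fr -EFinD.
have BF : ProperFilter (filter_from D B).
  apply: filter_from_proper; last by move=> s' _; exists s'; exact: lexx.
  apply: filter_from_filter; first exact: F_proper.2.
  move=> s s' Ds Ds'; have [ss'|s's] := leP (g s) (g s').
    by exists s => // y ys; split=> //; exact: le_trans ss'.
  by exists s' => // y ys; split=> //; exact: le_trans (ltW s's).
have [U [UU BU]] := ultraFilterLemma BF.
have UB s' : D s' -> U (B s') by move=> Ds'; apply: BU; exists s'.
have [z zP] : exists z, forall w : dual X, w s @[s --> U] --> (w z : R).
  have [s' Ds'] := F_proper.2; have [a ga] := gfin _ Ds'.
  have [M M0 MP] := prox_sublevel_bounded a xu.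
  apply: (reflexive_ultra_cvg X_reflexive (x := id) UU M0).
  apply: filterS (UB _ Ds') => s; rewrite /B /= ga; exact: MP.
exists z => s'; have [Ds'|] := boolP (F s' < +oo)%E; last first.
  by rewrite ltey negbK => /eqP ->; rewrite addye// leey.
have [a ga] := gfin _ Ds'.
have BE : B s' = [set s | (g s <= a%:E)%E] by rewrite /B ga.
suff : B s' z by [].
apply: (closed_convex_weakly_closed (x := id) UU _ _ zP).
- by rewrite BE; exact: prox_sublevel_closed.
- by rewrite BE => y y' t; exact: prox_sublevel_convex.
- exact: UB.
Qed.

End existence.

(** Compare [s] with [s + t (y - s)]. Convexity of [F] bounds the variation
of [F], and the subgradient inequality for the squared norm, taken at the moving
point [z t] rather than at [s - x], bounds that of the quadratic term on the
right side. Divide by [t]; demicontinuity of the duality map lets [t --> 0]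
without differentiating the norm. *)
Lemma prox_set_subdifferential (dualX_strict : strictly_convex (dual X)) x s e :
  0 < e -> prox_set e F x s ->
  subdifferential F s (- (e^-1 *: duality_map (s - x))).
Proof.
move=> e0 sP; have [fs Fs] : exists r : R, F s = r%:E.
  have [s0 /proper_finE[r0 F0]] := F_proper.2.
  apply: proper_finE; rewrite ltey; apply/eqP => Fs.
  by have := sP s0; rewrite Fs F0 addye// -EFinD.
move=> y; have [/proper_finE[fy Fy]|] := boolP (F y < +oo)%E; last first.
  by rewrite ltey negbK => /eqP ->; rewrite leey.
rewrite Fs Fy -EFinD lee_fin.
rewrite dualNE dualZE.
pose z (t : R) := s - x + t *: (y - s).
have zlim : z t @[t --> 0^'+] --> s - x.
  rewrite -[X in _ --> X]addr0 -[X in _ --> _ + X](scale0r (y - s)).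
  apply: cvg_at_right_filter; apply: cvgD; first exact: cvg_cst.
  by apply: cvgZr_tmp; exact: cvg_id.
have := duality_map_demicontinuous dualX_strict (y := y - s) _ zlim.
move=> /(_ _)/(cvgM (cvg_cst e^-1)) lim.
suff : fs - fy <= e^-1 * duality_map (s - x) (y - s) by lra.
apply: (cvgr_to_ge lim); near=> t.
have t0 : 0 < t by near: t; exact: nbhs_right_gt.
have t1 : t < 1 by near: t; exact: nbhs_right_lt.
have t01 : 0 <= t <= 1 by rewrite !ltW.
have [r Fr rle] := convex_efun_fin t01 Fy Fs.
have := sP (t *: y + (1 - t) *: s); rewrite Fs Fr -!EFinD lee_fin.
have -> : t *: y + (1 - t) *: s - x = z t.
  by rewrite /z scalerBl scale1r scalerBr addrCA addrAC.
have := duality_map_subgradient (z t) (s - x).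
rewrite {2}/z opprD addNKr dualN dualZ => le1 le2.
have : t * (fs - fy) <= t * (e^-1 * duality_map (z t) (y - s)).
  have -> : e^-1 = 2 * (2 * e)^-1 by field; rewrite gt_eqF.
  have c0 : 0 < (2 * e)^-1 by rewrite invr_gt0 mulr_gt0.
  rewrite -(ler_pM2l c0) in le1.
  lra.
by rewrite ler_pM2l.
Unshelve. all: by end_near. Qed.

End prox.

(** * Limits of the proximal potentials *)

Section prox_potential.
Context {R : realType} {X : normedModType R}.
Hypotheses (X_reflexive : reflexive_space X)
  (dualX_strict : strictly_convex (dual X)).
Variable F : X -> \bar R.
Hypotheses (F_proper : proper_fun F) (F_convex : convex_efun F)
  (F_lsc : lower_semicontinuous F).
Variable rho : X.
Hypothesis rho_rep : v_representable F rho.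
Implicit Types (x y s : X) (u v w : dual X) (e : R).

Lemma reflexive_weak_cvg {T : Type} (G : set_system T) (u : T -> dual X) v :
  (forall y, u t y @[t --> G] --> (v y : R)) -> weak_cvg G u v.
Proof.
move=> uv phi; have [y phiE] := X_reflexive phi.
by rewrite phiE (_ : (fun t => phi (u t)) = (fun t => u t y))//; apply/funext.
Qed.

Lemma prox_potential_subdifferential x e : 0 < e ->
  subdifferential F (prox e F x) (- prox_potential F x e).
Proof.
move=> e0; apply: prox_set_subdifferential => //.
have [u ru] := rho_rep.
have [s sP] := prox_exists F_proper F_convex X_reflexive F_lsc x e0 ru.
exact: xgetI sP.
Qed.

Lemma norm_prox_potential x e : 0 < e ->
  `|prox_potential F x e| = e^-1 * `|prox e F x - x|.
Proof.
by move=> e0; rewrite normrZ norm_duality_map normfV gtr0_norm.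
Qed.

Lemma prox_potential_quotient x e : 0 < e ->
  prox_potential F x e = duality_map (prox_quotient F x e).
Proof.
by move=> e0; rewrite /prox_quotient duality_mapZ// invr_gt0.
Qed.

(** With [s] the proximal point, monotonicity between [s] and [rho] gives
[`|s - rho| ^+ 2 / e <= `|u| * `|s - rho|]. *)
Lemma norm_prox_potential_le e u : 0 < e -> subdifferential F rho u ->
  `|prox_potential F rho e| <= `|u|.
Proof.
move=> e0 ru.
set s := prox e F rho.
have mono : 0 <= - (e^-1 * `|s - rho| ^+ 2) - u (s - rho).
  have := subdifferential_monotone F_proper
    (prox_potential_subdifferential rho e0) ru.
  by rewrite dualDE !dualNE dualZE duality_mapxx.
have us := dual_ub u (s - rho); rewrite ler_norml in us.
have : e^-1 * `|s - rho| ^+ 2 <= `|u| * `|s - rho|.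
  by case/andP: us => us _; lra.
rewrite norm_prox_potential// -/s.
have [->|n0] := eqVneq `|s - rho| 0; first by rewrite !mulr0 normr_ge0.
by rewrite expr2 mulrA ler_pM2r// lt_neqAle eq_sym n0 normr_ge0.
Qed.

Lemma prox_cvg : prox e F rho @[e --> 0^'+] --> rho.
Proof.
have [u ru] := rho_rep; apply/cvgrPdist_le => d d0.
near=> e; have e0 : 0 < e by near: e; exact: nbhs_right_gt.
have := norm_prox_potential_le e0 ru.
rewrite norm_prox_potential// distrC ler_pdivrMl// => /le_trans; apply.
have ed : e < d / (`|u| + 1).
  by near: e; apply: nbhs_right_lt; rewrite divr_gt0// ltr_wpDl.
rewrite ltr_pdivlMr ?ltr_wpDl// in ed; lra.
Unshelve. all: by end_near. Qed.

(** [v] is opposite to the subgradient of least norm: the minimal section of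
the subdifferential. *)
Definition minimal_potential v := representing_potential F rho v /\
  forall u, subdifferential F rho u -> `|v| <= `|u|.

(** The midpoint of two minimal potentials is again representing, so its norm
is not smaller, and strict convexity of the dual applies. *)
Lemma minimal_potential_unique v w :
  minimal_potential v -> minimal_potential w -> v = w.
Proof.
move=> [vr vmin] [wr wmin].
apply: (strictly_convex_midpoint_eq (r := `|v|) dualX_strict) => //.
  by rewrite -[leRHS]normrN wmin.
rewrite -[leRHS]normrN; apply: vmin => y.
have [f Ff] := subdifferential_fin F_proper vr.
have := vr y; have := wr y; rewrite Ff; case: (F y) => [r||]//.
  rewrite -!EFinD !lee_fin !dualNE dualZE dualDE; lra.
by rewrite !leey.
Qed.

(** Pass to the limit in
[F s + (- v e) (y - s) <= F y], where [s = prox e F rho]: the potentials are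
bounded and [s --> rho], so [v e (y - s)] has the limit of [v e (y - rho)],
while lower semicontinuity handles [F s]. *)
Lemma prox_potential_ultra_cvg (U : set_system R) : UltraFilter U ->
  0^'+ `<=` U -> exists2 v, minimal_potential v &
    forall y, prox_potential F rho e y @[e --> U] --> (v y : R).
Proof.
move=> UU U0; have [u0 ru0] := rho_rep.
have Upos : \forall e \near U, 0 < e by apply: U0; exact: nbhs_right_gt.
have Ubd u : subdifferential F rho u ->
    \forall e \near U, `|prox_potential F rho e| <= `|u|.
  by move=> ru; apply: filterS Upos => e e0; exact: norm_prox_potential_le.
have [v _ vP] := dual_ultra_cvg UU (normr_ge0 u0) (Ubd _ ru0).
have sU : prox e F rho @[e --> U] --> rho.
  by apply: cvg_trans prox_cvg => A; exact: U0.
exists v => //; split; last first.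
  move=> u /Ubd uU; apply: dual_norm_le => // y.
  apply: (cvgr_to_le (cvg_norm (vP y))); apply: filterS uU => e eu.
  by rewrite (le_trans (dual_ub _ _))// ler_wpM2r.
move=> y; have [fr Fr] := subdifferential_fin F_proper ru0.
have [/(proper_finE F_proper)[fy Fy]|] := boolP (F y < +oo)%E; last first.
  by rewrite ltey negbK => /eqP ->; rewrite leey.
rewrite Fr Fy -EFinD lee_fin dualNE.
suff : fr <= fy + v (y - rho) by lra.
(* The last summand dominates the error made in replacing [y - s] by
   [y - rho]; it vanishes in the limit. *)
have lim : fy + (prox_potential F rho e (y - rho) +
     `|u0| * `|prox e F rho - rho|) @[e --> U] -->
     (fy + (v (y - rho) + `|u0| * `|rho - rho|) : R).
  apply: cvgD; first exact: cvg_cst.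
  apply: cvgD; first exact: vP.
  apply: cvgM; first exact: cvg_cst.
  by apply: cvg_norm; apply: cvgB => //; exact: cvg_cst.
rewrite subrr normr0 mulr0 addr0 in lim.
apply/ler_addgt0Pr => d d0; rewrite -lerBlDr.
apply: (cvgr_to_ge lim).
have Flsc : ((fr - d)%:E < F rho)%E by rewrite Fr lte_fin; lra.
have [V rV VF] := F_lsc Flsc.
have UV : \forall e \near U, V (prox e F rho) by exact: sU.
near=> e; have e0 : 0 < e by near: e.
have /VF : V (prox e F rho) by near: e.
have sub := prox_potential_subdifferential rho e0.
have [fs Fs] := subdifferential_fin F_proper sub.
have := sub y; rewrite Fs Fy -EFinD lee_fin lte_fin dualNE.
set s := prox e F rho.
have -> : y - s = (y - rho) - (s - rho) by rewrite opprB addrA subrK.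
rewrite dualB.
have := dual_ub (prox_potential F rho e) (s - rho); rewrite ler_norml => /andP[+ _].
have := norm_prox_potential_le e0 ru0 => /(ler_wpM2r (normr_ge0 (s - rho))).
lra.
Unshelve. all: by end_near. Qed.

(** Each ultrafilter limit is the one minimal potential, hence the whole
family converges to it. *)
Lemma prox_potential_cvg : exists2 v, minimal_potential v &
  forall y, prox_potential F rho e y @[e --> 0^'+] --> (v y : R).
Proof.
have [U [UU U0]] := ultraFilterLemma (at_right_proper_filter (0 : R)).
have [v vmin _] := prox_potential_ultra_cvg UU U0.
exists v => // y; apply: cvg_ultra => W UW W0.
by have [w /(minimal_potential_unique vmin) <-] := prox_potential_ultra_cvg UW W0.
Qed.

End prox_potential.

(** * Hilbert spaces *)

Section inner_product.
Context {R : realType} {X : normedModType R}.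
Variable ip : X -> X -> R.
Hypotheses (ipC : forall x y, ip x y = ip y x)
  (ip_linear : forall a x y z, ip (a *: x + y) z = a * ip x z + ip y z)
  (ip_norm : forall x, ip x x = `|x| ^+ 2).
Implicit Types x y z : X.

Lemma ip0 z : ip 0 z = 0.
Proof. by have := ip_linear (-1) 0 0 z; rewrite scaler0 addr0; lra. Qed.

Lemma ipZ (a : R) x z : ip (a *: x) z = a * ip x z.
Proof. by have := ip_linear a x 0 z; rewrite addr0 ip0 addr0. Qed.

Lemma ipDl x y z : ip (x + y) z = ip x z + ip y z.
Proof. by have := ip_linear 1 x y z; rewrite scale1r mul1r. Qed.

Lemma ipDr x y z : ip x (y + z) = ip x y + ip x z.
Proof. by rewrite ipC ipDl !(ipC x). Qed.

Lemma ipZr (a : R) x z : ip x (a *: z) = a * ip x z.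
Proof. by rewrite ipC ipZ ipC. Qed.

(** Expand the squared norm of [`|y| *: x - `|x| *: y]. *)
Lemma cauchy_schwarz x y : ip x y <= `|x| * `|y|.
Proof.
have [->|x0] := eqVneq x 0; first by rewrite ip0 normr0 mul0r.
have [->|y0] := eqVneq y 0; first by rewrite ipC ip0 normr0 mulr0.
have xy0 : 0 < `|x| * `|y| by rewrite mulr_gt0 ?normr_gt0.
have := sqr_ge0 `| `|y| *: x + (- `|x|) *: y|.
rewrite -ip_norm ipDl !ipDr !ipZ !ipZr (ipC y x) !ip_norm => h.
rewrite -(ler_pM2l xy0); nra.
Qed.

Lemma norm_cauchy_schwarz x y : `|ip x y| <= `|x| * `|y|.
Proof.
rewrite ler_norml cauchy_schwarz andbT lerNl -mulN1r -ipZ scaleN1r.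
by rewrite (le_trans (cauchy_schwarz _ _))// normrN.
Qed.

Lemma parallelogram x y :
  `|x - y| ^+ 2 = 2 * `|x| ^+ 2 + 2 * `|y| ^+ 2 - `|x + y| ^+ 2.
Proof.
rewrite -!ip_norm -(scaleN1r y) !ipDl !ipDr !ipZ !ipZr (ipC y x); lra.
Qed.

Hypothesis dualX_strict : strictly_convex (dual X).

(** By Cauchy-Schwarz [ip x] lies in the duality set of [x]. *)
Lemma duality_map_ip x y : duality_map x y = ip x y.
Proof.
have [|||u uE ux] := @bounded_linear_dual R X (ip x) `|x|.
- by [].
- by move=> a y1 y2; rewrite ipDr ipZr.
- exact: norm_cauchy_schwarz.
rewrite -uE; congr (dual_fun _ y); apply: duality_map_eq => //.
by apply/duality_setP; rewrite uE ip_norm.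
Qed.

Lemma duality_mapB x y : duality_map (x - y) = duality_map x - duality_map y.
Proof.
apply/val_inj/funext => z; rewrite -[LHS]/(duality_map (x - y) z).
rewrite -[RHS]/((duality_map x - duality_map y) z) dualDE dualNE.
by rewrite !duality_map_ip -scaleN1r ipDl ipZ mulN1r.
Qed.

Variable F : X -> \bar R.
Hypotheses (X_reflexive : reflexive_space X)
  (F_proper : proper_fun F) (F_convex : convex_efun F)
  (F_lsc : lower_semicontinuous F).

(** With [a] the difference of the displacements [s - x] and [s' - x'],
monotonicity at [s] and [s'] gives [ip a (a + (x - x')) <= 0], hence
[`|a| <= `|x - x'|] by Cauchy-Schwarz. *)
Lemma prox_potential_lipschitz x0 x x' e : v_representable F x0 -> 0 < e ->
  `|prox_potential F x e - prox_potential F x' e| <= e^-1 * `|x - x'|.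
Proof.
move=> rep e0.
rewrite /prox_potential -scalerBr -duality_mapB normrZ norm_duality_map.
rewrite normfV gtr0_norm// ler_pM2l ?invr_gt0//.
have := subdifferential_monotone F_proper
  (prox_potential_subdifferential X_reflexive dualX_strict F_proper F_convex
     F_lsc rep x e0)
  (prox_potential_subdifferential X_reflexive dualX_strict F_proper F_convex
     F_lsc rep x' e0).
rewrite /prox_potential; set s := prox e F x; set s' := prox e F x'.
rewrite -opprD -scalerN -scalerDr -duality_mapB dualNE dualZE duality_map_ip.
set a := s - x - (s' - x').
have -> : s - s' = a + (x - x').
  by rewrite /a opprB addrAC !addrA !subrK.
rewrite ipDr ip_norm => h.
have := norm_cauchy_schwarz a (x - x'); rewrite ler_norml => /andP[cs _].
have ha : `|a| ^+ 2 <= `|a| * `|x - x'|.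
  by rewrite oppr_ge0 pmulr_rle0 ?invr_gt0// in h; lra.
have [->//|n0] := eqVneq `|a| 0.
by rewrite expr2 ler_pM2l// lt_neqAle eq_sym n0 normr_ge0 in ha.
Qed.

End inner_product.

Section hilbert.
Context {R : realType} {X : completeNormedModType R}.
Variable ip : X -> X -> R.
Hypotheses (ipC : forall x y, ip x y = ip y x)
  (ip_linear : forall a x y z, ip (a *: x + y) z = a * ip x z + ip y z)
  (ip_norm : forall x, ip x x = `|x| ^+ 2).
Hypothesis dualX_strict : strictly_convex (dual X).

(** Choose a unit-ball vector [y] nearly norming [v]. Eventually both [q t] and
[q t0] have inner product with [y] above [`|v| - d], so [`|q t0 + q t|] is at
least [2 * (`|v| - d)], while the norms are at most [`|v|]: the parallelogram
law makes [`|q t0 - q t| ^+ 2] at most [8 * `|v| * d]. *)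
Lemma hilbert_cvg_of_weak_cvg {T : Type} (G : set_system T) (q : T -> X)
    (v : dual X) : ProperFilter G ->
  (\forall t \near G, `|q t| <= `|v|) ->
  (forall y, duality_map (q t) y @[t --> G] --> (v y : R)) ->
  cvg (q @ G).
Proof.
move=> GG qv Jq; apply: cauchy_cvg; apply: cauchy_exP => e /= e0.
(* Any [d] with [8 * `|v| * d < e ^+ 2] would do; the additive constant keeps
   the denominator positive when [v = 0]. *)
pose d : R := Num.min 1 (e ^+ 2 / (8 * `|v| + 5)).
have V0 : 0 <= `|v| by exact: normr_ge0.
have d0 : 0 < d.
  by rewrite lt_min ltr01/= divr_gt0 ?exprn_gt0//; lra.
have d1 : d <= 1 by rewrite ge_min lexx.
have de : d * (8 * `|v| + 4) < e ^+ 2.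
  have : d <= e ^+ 2 / (8 * `|v| + 5) by rewrite ge_min lexx orbT.
  by rewrite ler_pdivlMr; lra.
have [y y1 vy] : exists2 y : X, `|y| <= 1 & `|v| - d < v y.
  have [_ [y /= y1 <-]] := sup_adherent d0 (dual_norm_has_sup v).
  rewrite -/(dual_norm v) -dual_normE => vy.
  have [v0|v0] := lerP 0 (v y); first by exists y; rewrite ?(ger0_norm v0) in vy *.
  by exists (- y); rewrite ?normrN// dualN -(ltr0_norm v0).
have Gy : \forall t \near G, `|v| - d < duality_map (q t) y.
  exact: cvgr_gt (Jq y) _ vy.
have [t0 [qt0 /= t0y]] := filter_ex (filterI qv Gy).
exists (q t0); apply: filterS (filterI qv Gy) => t [qt /= ty].
rewrite -ball_normE /=.
rewrite (duality_map_ip ipC ip_linear ip_norm)// in t0y.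
rewrite (duality_map_ip ipC ip_linear ip_norm)// in ty.
have sum : 2 * (`|v| - d) <= `|q t0 + q t|.
  have := cauchy_schwarz ipC ip_linear ip_norm (q t0 + q t) y.
  rewrite (ipDl ip_linear); have := ler_wpM2l (normr_ge0 (q t0 + q t)) y1; lra.
have sq1 : `|q t0| ^+ 2 <= `|v| ^+ 2 by rewrite ler_sqr ?nnegrE ?normr_ge0.
have sq2 : `|q t| ^+ 2 <= `|v| ^+ 2 by rewrite ler_sqr ?nnegrE ?normr_ge0.
have sq3 : 4 * `|v| ^+ 2 - 8 * `|v| * d <= `|q t0 + q t| ^+ 2.
  have [vd|vd] := lerP 0 (`|v| - d).
    have := lerXn2r 2 (_ : 2 * (`|v| - d) \is Num.nneg) (normr_ge0 _) sum.
    by rewrite nnegrE => /(_ ltac:(lra)); have := sqr_ge0 d; lra.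
  have := sqr_ge0 `|q t0 + q t|.
  have : `|v| * (`|v| - d) <= 0 by rewrite mulr_ge0_le0// ltW.
  have := mulr_ge0 V0 (ltW d0); lra.
rewrite -ltr_sqr ?nnegrE ?(ltW e0)// (parallelogram ipC ip_linear ip_norm).
lra.
Qed.

End hilbert.

(** * Convergence to a representing potential *)

Theorem theorem13 (R : realType) (d N : nat) (hd : (1 <= d)%N) (hN : (1 <= N)%N)
    (D : domain R d) (bc : set ('rV[R]_d -> R))
    (X : completeNormedModType R)
    (X_strict : strictly_convex X)
    (X_reflexive : reflexive_space X)
    (X_densities : contains_functions D X (densities D bc N))
    (dualX_strict : strictly_convex (dual X))
    (F : X -> \bar R)
    (F_proper : proper_fun F)
    (F_convex : convex_efun F)
    (F_lsc : lower_semicontinuous F)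
    (rho_gs : X)
    (rho_gs_rep : v_representable F rho_gs) :
  exists v : dual X,
    [/\ representing_potential F rho_gs v,
        weak_cvg 0^'+ (prox_potential F rho_gs) v,
        weak_cvg 0^'+ (fun e => duality_map (prox_quotient F rho_gs e)) v &
        hilbert_norm X ->
          [/\ cvg (prox_quotient F rho_gs e @[e --> 0^'+]),
              v = duality_map (lim (prox_quotient F rho_gs e @[e --> 0^'+])) &
              forall (rho_gs' : X) (e : R), 0 < e ->
                `|v - prox_potential F rho_gs' e| <=
                  `|v - prox_potential F rho_gs e|
                  + e^-1 * `|rho_gs - rho_gs'|]].
Proof.
have [v [v_rep v_min] v_lim] := prox_potential_cvg X_reflexive dualX_strict
  F_proper F_convex F_lsc rho_gs_rep.
have quotient_lim y :
    duality_map (prox_quotient F rho_gs e) y @[e --> 0^'+] --> (v y : R).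
  apply: cvg_trans (v_lim y); apply: near_eq_cvg; near=> e.
  by rewrite prox_potential_quotient.
exists v; split => //; [exact: reflexive_weak_cvg|exact: reflexive_weak_cvg|].
move=> [ip [ipC ip_linear ip_norm]].
have q_cvg : cvg (prox_quotient F rho_gs e @[e --> 0^'+]).
  apply: (hilbert_cvg_of_weak_cvg ipC ip_linear ip_norm) quotient_lim => //.
  near=> e; rewrite -norm_duality_map -prox_potential_quotient//.
  by rewrite -[leRHS]normrN norm_prox_potential_le.
split=> //.
  apply/val_inj/funext => y.
  apply: norm_cvg_unique (quotient_lim y) _.
  exact: duality_map_demicontinuous.
move=> rho_gs' e e0.
apply: le_trans (ler_distD (prox_potential F rho_gs e) _ _) _.
rewrite lerD2l.
by rewrite (prox_potential_lipschitz ipC ip_linear ip_norm _ _ _ _ _ _ _ rho_gs_rep).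
Unshelve. all: by end_near. Qed.
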